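(* Let $\mathcal{H}$ be a set of first-order frame conditions, each of which is (the universal closure of) a Horn clause of one of the two forms $$w_1 R u_1 \wedge \ldots \wedge w_m R u_m \to v R z \qquad\text{or}\qquad w_1 R u_1 \wedge \ldots \wedge w_m R u_m \to \bot ,$$ where $m\ge 0$ may depend on the clause and $w_i,u_i,v,z$ are (not necessarily distinct) variables ranging over worlds. Let $\mathcal{C}_{\mathsf L}$ be the class of all Kripke frames satisfying every condition in $\mathcal{H}$. If a modal logic $\mathsf L$ is complete with respect to $\mathcal{C}_{\mathsf L}$, then $\mathsf L$ enjoys the Lyndon Interpolation Property (and hence also the Craig Interpolation Property).
   Context: Modal formulas are in negation normal form: they are built from positive propositional atoms $P$, negative propositional atoms $\overline{P}$ (for $P$ in a countable set $\mathsf{Prop}$), $\top$ and $\bot$ by $\wedge,\vee,\Box,\Diamond$. The negation $\overline{A}$ of a formula is defined via the De Morgan laws, and $A\to B:=\overline{A}\vee B$. A Kripke frame is a pair $(W,R)$ with $W\neq\varnothing$ and $R\subseteq W\times W$; a Kripke model is $(W,R,V)$ with $V:\mathsf{Prop}\to 2^W$. Satisfaction $\mathcal{M},w\Vdash A$ is standard: $P$ holds at $w$ iff $w\in V(P)$; $\overline{P}$ holds at $w$ iff $w\notin V(P)$; $\top$ always holds, $\bot$ never holds; $\wedge,\vee$ are classical; $\Box A$ holds at $w$ iff $A$ holds at all $u$ with $wRu$; $\Diamond A$ holds at $w$ iff $A$ holds at some $u$ with $wRu$. A modal logic $\mathsf L$ is complete w.r.t. a class of frames if it is characterized by it: $\mathsf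 L\vdash A$ iff $A$ holds at every world of every Kripke model whose frame is in the class. $\mathsf L$ has the Lyndon Interpolation Property (LIP) if whenever $\mathsf L\vdash A\to B$ there is a modal formula $C$ such that $\mathsf L\vdash A\to C$, $\mathsf L\vdash C\to B$, every positive propositional atom $P$ occurring in $C$ occurs (as a positive atom) in both $A$ and $B$, and every negative propositional atom $\overline{P}$ occurring in $C$ occurs in both $A$ and $B$. The Craig Interpolation Property (CIP) is the same with polarities disregarded: every $P\in\mathsf{Prop}$ occurring in $C$ (positively or negatively) occurs in both $A$ and $B$. *)

(* Defs.v *)
From mathcomp Require Import all_boot.

Set Implicit Arguments.
Unset Strict Implicit.
Unset Printing Implicit Defensive.

Inductive form (Atom : Type) : Type :=
| Pos of Atom
| Neg of Atom
| Top
| Bot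
| And of form Atom & form Atom
| Or of form Atom & form Atom
| Box of form Atom
| Dia of form Atom.

Arguments Top {Atom}.
Arguments Bot {Atom}.

Fixpoint dual (Atom : Type) (A : form Atom) : form Atom :=
  match A with
  | Pos p => Neg p
  | Neg p => Pos p
  | Top => Bot
  | Bot => Top
  | And A1 A2 => Or (dual A1) (dual A2)
  | Or A1 A2 => And (dual A1) (dual A2)
  | Box A1 => Dia (dual A1)
  | Dia A1 => Box (dual A1)
  end.

Definition imp (Atom : Type) (A B : form Atom) : form Atom := Or (dual A) B.

Fixpoint pos_atoms (Atom : Type) (A : form Atom) : seq Atom :=
  match A with
  | Pos p => [:: p]
  | Neg _ | Top | Bot => [::]
  | And A1 A2 | Or A1 A2 => pos_atoms A1 ++ pos_atoms A2
  | Box A1 | Dia A1 => pos_atoms A1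
  end.

Fixpoint neg_atoms (Atom : Type) (A : form Atom) : seq Atom :=
  match A with
  | Neg p => [:: p]
  | Pos _ | Top | Bot => [::]
  | And A1 A2 | Or A1 A2 => neg_atoms A1 ++ neg_atoms A2
  | Box A1 | Dia A1 => neg_atoms A1
  end.

Definition atoms (Atom : Type) (A : form Atom) : seq Atom :=
  pos_atoms A ++ neg_atoms A.

Record frame := Frame {
  world :> Type;
  acc : world -> world -> Prop;
  world_inhabited : inhabited world
}.

Record model (Atom : Type) := Model {
  model_frame :> frame;
  valuation : Atom -> model_frame -> Prop
}.

Fixpoint sat (Atom : Type) (M : model Atom) (w : M) (A : form Atom) : Prop :=
  match A with
  | Pos p => valuation p w
  | Neg p => ~ valuation p w
  | Top => True
  | Bot => False
  | And A1 A2 => sat w A1 /\ sat w A2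
  | Or A1 A2 => sat w A1 \/ sat w A2
  | Box A1 => forall u : M, acc w u -> sat u A1
  | Dia A1 => exists2 u : M, acc w u & sat u A1
  end.

(** A modal logic is given by its set of theorems.  No closure conditions are
    imposed: completeness with respect to a class of frames makes it the set of
    formulas valid on that class, which is a normal modal logic. *)
Definition logic (Atom : Type) := form Atom -> Prop.

Definition complete_wrt (Atom : Type) (L : logic Atom) (C : frame -> Prop) :
    Prop :=
  forall A : form Atom,
    L A <-> (forall M : model Atom, C M -> forall w : M, sat w A).

(** Horn frame conditions.  World variables are natural numbers, and a pair
    [(x, y)] stands for the atomic formula [x R y]. *)

Inductive horn : Type :=
| HornR of seq (nat * nat) & nat & nat
| HornBot of seq (nat * nat).

Definition body_holds (F : frame) (s : nat -> F) (body : seq (nat * nat)) :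
    Prop :=
  forall e : nat * nat, e \in body -> acc (s e.1) (s e.2).

(** Quantifying over assignments [s] of all variables is the universal closure;
    since frames are nonempty, the variables not occurring in the clause are
    immaterial. *)
Definition satisfies_horn (F : frame) (h : horn) : Prop :=
  match h with
  | HornR body v z => forall s : nat -> F, body_holds s body -> acc (s v) (s z)
  | HornBot body => forall s : nat -> F, body_holds s body -> False
  end.

Definition horn_class (H : horn -> Prop) (F : frame) : Prop :=
  forall h : horn, H h -> satisfies_horn F h.

Definition LIP (Atom : eqType) (L : logic Atom) : Prop :=
  forall A B : form Atom, L (imp A B) ->
  exists C : form Atom,
    [/\ L (imp A C),
        L (imp C B),
        (forall p, p \in pos_atoms C ->
           p \in pos_atoms A /\ p \in pos_atoms B) &
        (forall p, p \in neg_atoms C ->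
           p \in neg_atoms A /\ p \in neg_atoms B)].

Definition CIP (Atom : eqType) (L : logic Atom) : Prop :=
  forall A B : form Atom, L (imp A B) ->
  exists C : form Atom,
    [/\ L (imp A C),
        L (imp C B) &
        (forall p, p \in atoms C -> p \in atoms A /\ p \in atoms B)].

(* Main.v *)
(** Suppose [A -> B] is valid on the class but has no Lyndon interpolant.  By a
    finite separation argument there are, for every [n], pointed models of the
    class satisfying [A] and refuting [B] respectively such that the first [n]
    formulas of the common polarised language are transferred from the former
    to the latter.  Their ultraproducts are again in the class, are modally
    saturated, and transfer the whole common language, so that transfer of the
    common language is a directed bisimulation between them.  Horn clauses are
    preserved by products and by induced subframes, hence the set of related
    pairs is a frame of the class; it carries a valuation for which truth
    passes from the first ultraproduct for subformulas of [A] and to the second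
    one for subformulas of [B], which refutes [A -> B]. *)
Require Import Defs.
From mathcomp Require Import all_boot.
From mathcomp Require Import boolp classical_sets filter.

Set Implicit Arguments.
Unset Strict Implicit.
Unset Printing Implicit Defensive.

Local Open Scope classical_set_scope.

(** * Countability of the set of formulas *)

Fixpoint form_encode (Atom : Type) (A : form Atom) : GenTree.tree Atom :=
  match A with
  | Pos p => GenTree.Node 0 [:: GenTree.Leaf p]
  | Neg p => GenTree.Node 1 [:: GenTree.Leaf p]
  | Top => GenTree.Node 2 [::]
  | Bot => GenTree.Node 3 [::]
  | And A1 A2 => GenTree.Node 4 [:: form_encode A1; form_encode A2]
  | Or A1 A2 => GenTree.Node 5 [:: form_encode A1; form_encode A2]
  | Box A1 => GenTree.Node 6 [:: form_encode A1]
  | Dia A1 => GenTree.Node 7 [:: form_encode A1]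
  end.

Fixpoint form_decode (Atom : Type) (t : GenTree.tree Atom) : form Atom :=
  match t with
  | GenTree.Node 0 [:: GenTree.Leaf p] => Pos p
  | GenTree.Node 1 [:: GenTree.Leaf p] => Neg p
  | GenTree.Node 3 _ => Bot
  | GenTree.Node 4 [:: t1; t2] => And (form_decode t1) (form_decode t2)
  | GenTree.Node 5 [:: t1; t2] => Or (form_decode t1) (form_decode t2)
  | GenTree.Node 6 [:: t1] => Box (form_decode t1)
  | GenTree.Node 7 [:: t1] => Dia (form_decode t1)
  | _ => Top
  end.

Lemma form_encodeK (Atom : Type) :
  cancel (@form_encode Atom) (@form_decode Atom).
Proof. by elim=> //= [A -> B -> | A -> B -> | A -> | A ->]. Qed.

Lemma form_enumeration (Atom : countType) (S : form Atom -> Prop) :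
  S Top ->
  exists e : nat -> form Atom,
    (forall n, S (e n)) /\ forall C, S C -> exists n, e n = C.
Proof.
move=> STop.
pose f n : form Atom := oapp (@form_decode Atom) Top (unpickle n).
(* [Top] replaces every decoded formula outside [S], so the enumeration never leaves [S]. *)
exists (fun n => if pselect (S (f n)) then f n else Top); split=> [n | C SC].
  by case: pselect.
exists (pickle (form_encode C)).
by rewrite /f pickleK /= form_encodeK; case: pselect.
Qed.

(** * Negation, implication and validity *)

Lemma dualK (Atom : Type) : involutive (@dual Atom).
Proof. by elim=> //= [A -> B -> | A -> B -> | A -> | A ->]. Qed.

Lemma pos_atoms_dual (Atom : Type) (A : form Atom) :
  pos_atoms (dual A) = neg_atoms A.
Proof. by elim: A => //= A -> B ->. Qed.

Lemma neg_atoms_dual (Atom : Type) (A : form Atom) :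
  neg_atoms (dual A) = pos_atoms A.
Proof. by rewrite -{2}(dualK A) pos_atoms_dual. Qed.

Lemma sat_dual (Atom : Type) (M : model Atom) (A : form Atom) (w : M) :
  sat w (dual A) <-> ~ sat w A.
Proof.
elim: A w => [p|p|||A IHA B IHB|A IHA B IHB|A IHA|A IHA] w /=.
- by [].
- by rewrite not_notE.
- by split=> // /(_ I).
- by split=> // _ [].
- split=> [[/IHA nA []|/IHB nB []]|/not_andP [nA|nB]] //.
  + by left; apply/IHA.
  + by right; apply/IHB.
- split=> [[/IHA nA /IHB nB] []//|/not_orP [nA nB]].
  by split; [apply/IHA|apply/IHB].
- split=> [[u wu /IHA nA] /(_ u wu)//|nbox].
  apply: contrapT => ndia; apply: nbox => u wu; apply: contrapT => nA.
  by apply: ndia; exists u => //; apply/IHA.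
- split=> [box [u wu Au]|ndia u wu].
  + by move/IHA: (box u wu); apply.
  + by apply/IHA => Au; apply: ndia; exists u.
Qed.

Lemma sat_imp (Atom : Type) (M : model Atom) (A B : form Atom) (w : M) :
  sat w (imp A B) <-> (sat w A -> sat w B).
Proof.
split=> [[/sat_dual nA|//] /nA //|AB].
by have [/AB|/sat_dual] := pselect (sat w A); [right|left].
Qed.

Lemma complete_imp (Atom : Type) (L : logic Atom) (K : frame -> Prop)
    (LK : complete_wrt L K) (A B : form Atom) :
  L (imp A B) <->
  forall M : model Atom, K M -> forall w : M, sat w A -> sat w B.
Proof.
split=> [/LK AB M KM w|AB]; first by apply/sat_imp/AB.
by apply/LK => M KM w; apply/sat_imp/AB.
Qed.

(** * Polarised languages and finite separation *)

Definition over (Atom : Type) (P N : pred Atom) (C : form Atom) : Prop :=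
  all P (pos_atoms C) && all N (neg_atoms C).

Lemma over_dual (Atom : Type) (P N : pred Atom) (C : form Atom) :
  over P N (dual C) <-> over N P C.
Proof. by rewrite /over pos_atoms_dual neg_atoms_dual andbC. Qed.

Lemma over_And (Atom : Type) (P N : pred Atom) (C D : form Atom) :
  over P N (And C D) <-> over P N C /\ over P N D.
Proof. by rewrite /over /= !all_cat andbACA; split=> /andP. Qed.

Lemma over_Or (Atom : Type) (P N : pred Atom) (C D : form Atom) :
  over P N (Or C D) <-> over P N C /\ over P N D.
Proof. exact: over_And. Qed.

Lemma over_self (Atom : eqType) (A : form Atom) :
  over (mem (pos_atoms A)) (mem (neg_atoms A)) A.
Proof. by apply/andP; split; apply/allP. Qed.

Definition pointed (Atom : Type) := {M : model Atom & M}.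

Definition holds (Atom : Type) (t : pointed Atom) (C : form Atom) : Prop :=
  sat (projT2 t) C.

Lemma finite_separation (Atom : Type) (P N : pred Atom)
    (e : nat -> form Atom) (over_e : forall k, over P N (e k)) (n : nat)
    (S T : pointed Atom -> Prop) :
  (forall s t, S s -> T t -> exists2 k, k < n & holds s (e k) /\ ~ holds t (e k)) ->
  exists C, [/\ over P N C, forall s, S s -> holds s C &
                forall t, T t -> ~ holds t C].
Proof.
elim: n S T => [|n IHn] S T sep.
  (* With no formula left to separate them, [S] and [T] cannot both be inhabited. *)
  have [[t Tt]|nT] := pselect (exists t, T t).
    by exists Bot; split=> [|s Ss|? ? []] //; have [] := sep _ _ Ss Tt.
  by exists Top; split=> // t Tt; case: nT; exists t.
(* Two weaker tasks no longer need [e n]: separating from [T] the points of [S] that refute [e n]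
   (by [D]), and separating from [S] the points of [T] that satisfy it (by [D']). *)
have [s t [Ss ns] Tt|D [oD SD TD]] :=
    IHn (fun s => S s /\ ~ holds s (e n)) T.
  have [k] := sep s t Ss Tt; rewrite ltnS leq_eqVlt => /predU1P[->|kn] [sk tk] //.
  by exists k.
have [s t Ss [Tt nt]|D' [oD' SD' TD']] :=
    IHn S (fun t => T t /\ holds t (e n)).
  have [k] := sep s t Ss Tt; rewrite ltnS leq_eqVlt => /predU1P[->|kn] [sk tk] //.
  by exists k.
exists (And (Or (e n) D) D'); split=> [|s Ss|t Tt].
- by apply/over_And; split=> //; apply/over_Or; split.
- split; last exact: SD'.
  by have [sn|sn] := pselect (holds s (e n)); [left|right; apply: SD].
- by move=> [[tn|tD] tD']; [apply: (TD' t)|apply: (TD t)].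
Qed.

(** * Directed bisimulation and saturation *)

Definition transfer (Atom : Type) (P N : pred Atom) (M M' : model Atom)
    (x : M) (x' : M') : Prop :=
  forall C, over P N C -> sat x C -> sat x' C.

(** Contraposition through [dual] swaps the polarities; this turns the forth condition into the back
    condition. *)
Lemma transfer_dual (Atom : Type) (P N : pred Atom) (M M' : model Atom)
    (x : M) (x' : M') :
  transfer P N x x' -> transfer N P x' x.
Proof.
move=> xx' C oC x'C; apply: contrapT => /sat_dual/xx' xC.
by have /sat_dual : sat x' (dual C) by apply: xC; apply/over_dual.
Qed.

(** As [S] is closed under conjunction, single formulas [Dia C] already express that every finite
    part of [S] is satisfied at some successor. *)
Definition modally_saturated (Atom : Type) (M : model Atom) : Prop :=
  forall (x : M) (S : form Atom -> Prop),
    S Top -> (forall C D, S C -> S D -> S (And C D)) ->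
    (forall C, S C -> sat x (Dia C)) ->
  exists2 y, acc x y & forall C, S C -> sat y C.

(** The formulas over [P] and [N] true at [y] are closed under conjunction, and their diamonds hold
    at [x], hence at [x']; saturation realises them all at one successor of [x']. *)
Lemma transfer_forth (Atom : Type) (P N : pred Atom) (M M' : model Atom)
    (x y : M) (x' : M') :
  modally_saturated M' -> transfer P N x x' -> acc x y ->
  exists2 y', acc x' y' & transfer P N y y'.
Proof.
move=> satM' xx' xy.
have [||C [oC yC]|y' x'y' yy'] := satM' x' (fun C => over P N C /\ sat y C).
- by [].
- by move=> C D [oC yC] [oD yD]; split=> //; apply/over_And.
- by apply: xx' => //; exists y.
- by exists y' => // C oC yC; apply: yy'.
Qed.

(** * Amalgamation in the product of two frames *)

Section Amalgam.

Variables (Atom : Type) (M M' : model Atom) (Z : M -> M' -> Prop).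
Variables (w : M) (w' : M') (ww' : Z w w').
Variable V : Atom -> M -> M' -> Prop.

Definition related_pairs : Type := {p : M * M' | Z p.1 p.2}.

Definition root_pair : related_pairs := exist _ (w, w') ww'.

Definition amalgam_frame : frame :=
  @Frame related_pairs
    (fun p q => acc (sval p).1 (sval q).1 /\ acc (sval p).2 (sval q).2)
    (inhabits root_pair).

Definition amalgam : model Atom :=
  @Model Atom amalgam_frame (fun a p => V a (sval p).1 (sval p).2).

Lemma amalgam_horn (H : horn -> Prop) :
  horn_class H M -> horn_class H M' -> horn_class H amalgam.
Proof.
move=> HM HM' h Hh; move: (HM h Hh) (HM' h Hh).
case: h {Hh} => [body v z|body] /= hM hM' s body_s.
- split; [apply: (hM (fun k => (sval (s k)).1))
        | apply: (hM' (fun k => (sval (s k)).2))];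
  by move=> e /body_s [].
- by apply: (hM (fun k => (sval (s k)).1)) => e /body_s [].
Qed.

End Amalgam.

(** On frames [f] is a bounded morphism. Formulas are monotone in their literals, so each polarity
    needs only one direction of agreement between the valuations. *)
Lemma sat_lift (Atom : Type) (P N : pred Atom) (M K : model Atom) (f : K -> M) :
  (forall k l, acc k l -> acc (f k) (f l)) ->
  (forall k y, acc (f k) y -> exists2 l, acc k l & f l = y) ->
  (forall a k, P a -> valuation a (f k) -> valuation a k) ->
  (forall a k, N a -> valuation a k -> valuation a (f k)) ->
  forall C, over P N C -> forall k, sat (f k) C -> sat k C.
Proof.
move=> f_acc f_lift fP fN.
elim=> [p|p|||A IHA B IHB|A IHA B IHB|A IHA|A IHA] oC k //=.
- by apply: fP; move: oC; rewrite /over /= !andbT.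
- by move=> nfk kp; apply/nfk/fN => //; move: oC; rewrite /over /= !andbT.
- by have /over_And [oA oB] := oC; move=> [/IHA ? /IHB ?]; split; auto.
- by have /over_And [oA oB] := oC; move=> [/IHA ?|/IHB ?]; [left|right]; auto.
- by move=> box l kl; apply: IHA => //; apply/box/f_acc.
- by move=> [y ky yA]; have [l kl ly] := f_lift k y ky; exists l => //;
    apply: IHA => //; rewrite ly.
Qed.

Lemma amalgamation (Atom : eqType) (H : horn -> Prop) (A B : form Atom)
    (P := [predI mem (pos_atoms A) & mem (pos_atoms B)])
    (N := [predI mem (neg_atoms A) & mem (neg_atoms B)])
    (M M' : model Atom) (w : M) (w' : M') :
  horn_class H M -> horn_class H M' ->
  modally_saturated M -> modally_saturated M' ->
  transfer P N w w' -> sat w A -> ~ sat w' B ->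
  exists (K : model Atom) (k : K), [/\ horn_class H K, sat k A & ~ sat k B].
Proof.
move=> HM HM' satM satM' ww' wA w'B.
(* The least valuation preserving the positive atoms of [A] from [x] and those of [dual B] from
   [x']. Negative literals survive because an atom that could spoil one has the same polarity in [A]
   and [B], so transfer applies to it. *)
pose V a (x : M) (x' : M') := (a \in pos_atoms A /\ valuation a x) \/
                              (a \in neg_atoms B /\ valuation a x').
exists (amalgam ww' V), (root_pair ww'); split; first exact: amalgam_horn.
- apply: (sat_lift (f := fun p : amalgam ww' V => (sval p).1) _ _ _ _
            (over_self A) (k := root_pair ww') wA).
  + by move=> k l [].
  + move=> [[x x'] /= xx'] y xy.
    have [y' x'y' yy'] := transfer_forth satM' xx' xy.
    by exists (exist _ (y, y') yy').
  + by move=> a k aA ka; left.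
  + move=> a [[x x'] /= xx'] aA [[_ //]|[/= aB x'a]]; apply: contrapT => xa.
    by apply: (xx' (Neg a)) => //=; rewrite /over /= andbT; apply/andP.
- apply/sat_dual.
  have oB : over (mem (neg_atoms B)) (mem (pos_atoms B)) (dual B).
    exact/over_dual/over_self.
  apply: (sat_lift (f := fun p : amalgam ww' V => (sval p).2) _ _ _ _ oB).
  + by move=> k l [].
  + move=> [[x x'] /= xx'] y' x'y'.
    have [y xy y'y] := transfer_forth satM (transfer_dual xx') x'y'.
    by exists (exist _ (y, y') (transfer_dual y'y)).
  + by move=> a k aB ka; right.
  + move=> a [[x x'] /= xx'] aB [[/= aA xa]|[_ //]].
    by apply: (xx' (Pos a)) => //=; rewrite /over /= !andbT; apply/andP.
  + exact/sat_dual.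
Qed.

(** * Ultraproducts of models and their saturation *)

Section Ultraproduct.

Variables (Atom : Type) (U : set_system nat) (UU : UltraFilter U).
Variables (M : nat -> model Atom) (w : forall i, M i).

Definition ultraproduct_frame : frame :=
  @Frame (forall i, M i) (fun x y => U [set i | acc (x i) (y i)]) (inhabits w).

(** Almost equal sequences are not identified: in the absence of equality the
    quotient is not needed. *)
Definition ultraproduct : model Atom :=
  @Model Atom ultraproduct_frame (fun a x => U [set i | valuation a (x i)]).

Lemma ultra_setC (X : set nat) : U (~` X) <-> ~ U X.
Proof.
split=> [UnX UX|nUX]; last by have [] := in_ultra_setVsetC X UU.
by apply: (filter_not_empty U); rewrite -(setICr X); apply: filterI.
Qed.

Lemma los (A : form Atom) (x : ultraproduct) :
  sat x A <-> U [set i | sat (x i) A].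
Proof.
elim: A x => [p|p|||A IHA B IHB|A IHA B IHB|A IHA|A IHA] x /=.
- by [].
- by rewrite -ultra_setC.
- by split=> // _; apply: filterT.
- by split=> // U0; apply: (filter_not_empty U).
- split=> [[/IHA UA /IHB UB]|UAB]; first exact: filterI.
  by split; [apply/IHA|apply/IHB]; apply: filterS UAB => i [].
- split=> [[/IHA|/IHB]|UAB].
  + by apply: filterS => i; left.
  + by apply: filterS => i; right.
  have [UA|/ultra_setC UnA] := pselect (U [set i | sat (x i) A]).
    by left; apply/IHA.
  by right; apply/IHB; apply: filterS (filterI UAB UnA) => i [[sA /(_ sA)|]].
- split=> [box|Ubox y xy].
    apply: contrapT => /ultra_setC UnB.
    (* A successor refuting [A] wherever there is one; elsewhere [w i] serves as an arbitrary
       default. *)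
    have wit i : exists y, ~ (forall u, acc (x i) u -> sat u A) ->
        acc (x i) y /\ ~ sat y A.
      have [?|nbox] := pselect (forall u, acc (x i) u -> sat u A).
        by exists (w i).
      apply: contrapT => nex; apply: nbox => u xu; apply: contrapT => nA.
      by apply: nex; exists u.
    pose y i := sval (cid (wit i)).
    have /box/IHA UA : U [set i | acc (x i) (y i)].
      by apply: filterS UnB => i nb; have [] := svalP (cid (wit i)) nb.
    have [i [yA nb]] := filter_ex (filterI UA UnB).
    by have [] := svalP (cid (wit i)) nb.
  by apply/IHA; apply: filterS (filterI Ubox xy) => i [+ xyi]; apply.
- split=> [[y xy /IHA UA]|Udia].
    by apply: filterS (filterI xy UA) => i [xyi yA]; exists (y i).
  have wit i : exists y, (exists2 u, acc (x i) u & sat u A) ->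
      acc (x i) y /\ sat y A.
    have [[u xu uA]|nex] := pselect (exists2 u, acc (x i) u & sat u A).
      by exists u.
    by exists (w i) => /nex.
  exists (fun i => sval (cid (wit i))).
    by apply: filterS Udia => i nb; have [] := svalP (cid (wit i)) nb.
  apply/IHA.
  by apply: filterS Udia => i nb; have [] := svalP (cid (wit i)) nb.
Qed.

(** A body is a finite list, so the index sets of its atoms intersect in a member of [U], on which
    the clause applies coordinatewise. *)
Lemma ultraproduct_horn (H : horn -> Prop) :
  (forall i, horn_class H (M i)) -> horn_class H ultraproduct.
Proof.
move=> HM h Hh.
have body_U body (s : nat -> ultraproduct) : body_holds s body ->
    U [set i | body_holds (fun k => s k i) body].
  elim: body => [|e body IH] body_s; first by apply: filterE => i e.
  have Ue := body_s e (mem_head _ _).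
  have Ub : U [set i | body_holds (fun k => s k i) body].
    by apply: IH => d db; apply: body_s; rewrite in_cons db orbT.
  apply: filterS (filterI Ue Ub) => i [se sb] d.
  by rewrite in_cons => /predU1P[->//|]; apply: sb.
case: h Hh => [body v z|body] Hh /= s /body_U Us.
- by apply: filterS Us => i; apply: (HM i _ Hh).
- by have [i] := filter_ex Us; apply: (HM i _ Hh).
Qed.

Lemma countable_saturation (Q : nat -> forall i, M i -> Prop) :
  \oo `<=` U ->
  (forall n, U [set i | exists y : M i, forall k, k < n -> Q k i y]) ->
  exists y : forall i, M i, forall k, U [set i | Q k i (y i)].
Proof.
move=> ooU fin_sat.
pose ok n i := exists y : M i, forall k, k < n -> Q k i y.
(* At coordinate [i], satisfy as many of the first [i] conditions as possible. *)
have wit i m : exists y : M i, forall n, n <= m -> ok n i ->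
    forall k, k < n -> Q k i y.
  elim: m => [|m [y IHm]]; first by exists (w i) => n; rewrite leqn0 => /eqP->.
  have [[z Qz]|nok] := pselect (ok m.+1 i).
    by exists z => n nm _ k kn; apply: Qz; apply: leq_trans nm.
  exists y => n; rewrite leq_eqVlt => /predU1P[->//|nm]; exact: IHm.
exists (fun i => sval (cid (wit i i))) => k.
(* The choice at [i] meets condition [k] once [i] exceeds [k] and the first [k.+1] conditions are
   jointly satisfiable there; both happen on members of [U]. *)
have Uk : U [set i | k.+1 <= i] by apply: ooU; exists k.+1.
apply: filterS (filterI Uk (fin_sat k.+1)) => i [ki oki].
exact: (svalP (cid (wit i i)) _ ki oki k (ltnSn k)).
Qed.

End Ultraproduct.

Lemma ultraproduct_saturated (Atom : countType) (U : set_system nat)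
    (UU : UltraFilter U) (M : nat -> model Atom) (w : forall i, M i) :
  \oo `<=` U -> modally_saturated (ultraproduct U w).
Proof.
move=> ooU x S STop SAnd Sdia.
have [e [Se eS]] := form_enumeration STop.
pose Q k i (y : M i) := acc (x i) y /\ sat y (e k).
have [n|y Qy] := countable_saturation UU w (Q := Q) ooU.
  (* [C] is the conjunction of the first [n] members of the enumeration, so [Dia C] alone yields the
     finite satisfiability required. *)
  have [C SC Ce] : exists2 C, S C & forall i (y : M i),
      sat y C -> forall k, k < n -> sat y (e k).
    elim: n => [|n [C SC Ce]]; first by exists Top.
    exists (And C (e n)) => [|i y [yC yn] k]; first exact: SAnd.
    by rewrite ltnS leq_eqVlt => /predU1P[->//|]; apply: Ce.
  have /los := Sdia C SC; apply: filterS => i [y xy yC].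
  by exists y => k kn; split=> //; apply: Ce yC k kn.
exists y; first by apply: filterS (Qy 0) => i [].
by move=> _ /eS [k <-]; apply/los; apply: filterS (Qy k) => i [].
Qed.

(** * Interpolation *)

Lemma LIP_CIP (Atom : eqType) (L : logic Atom) : LIP L -> CIP L.
Proof.
move=> lip A B /lip [C [AC CB posC negC]]; exists C; split=> // p.
rewrite !mem_cat => /orP[/posC|/negC] [pA pB];
  by rewrite pA pB ?orbT.
Qed.

Theorem theorem23 (Atom : countType) (H : horn -> Prop) (L : logic Atom)
    (L_complete : complete_wrt L (horn_class H)) :
  LIP L /\ CIP L.
Proof.
suff lip : LIP L by split=> //; apply: LIP_CIP.
move=> A B /(complete_imp L_complete) AB.
pose P : pred Atom := [predI mem (pos_atoms A) & mem (pos_atoms B)].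
pose N : pred Atom := [predI mem (neg_atoms A) & mem (neg_atoms B)].
have [e [over_e e_over]] := @form_enumeration _ (over P N) isT.
pose S (s : pointed Atom) := horn_class H (projT1 s) /\ holds s A.
pose T (t : pointed Atom) := horn_class H (projT1 t) /\ ~ holds t B.
(* Either finitely many formulas of the common language separate [S] from [T], which gives the
   interpolant, or each [n] has an unseparated pair. *)
have [[n sep]|no_sep] := pselect (exists n, forall s t, S s -> T t ->
    exists2 k, k < n & holds s (e k) /\ ~ holds t (e k)).
  have [C [/andP[/allP posC /allP negC] SC TC]] := finite_separation over_e sep.
  exists C; split.
  - apply/(complete_imp L_complete) => M HM w wA.
    exact: (SC (existT _ M w)).
  - apply/(complete_imp L_complete) => M HM w wC; apply: contrapT => wB.
    exact: (TC (existT _ M w)).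
  - by move=> p /posC/andP.
  - by move=> p /negC/andP.
exfalso.
have /choice [st st_spec] n : exists st : pointed Atom * pointed Atom,
    [/\ S st.1, T st.2 &
        forall k, k < n -> holds st.1 (e k) -> holds st.2 (e k)].
  apply: contrapT => nst; apply: no_sep; exists n => s t Ss Tt.
  apply: contrapT => nk; apply: nst; exists (s, t); split=> // k kn sk.
  by apply: contrapT => tk; apply: nk; exists k.
(* Refining the cofinite filter makes each initial segment of indices negligible, so [e k] is
   transferred at almost all indices. *)
have [U [UU ooU]] := ultraFilterLemma eventually_filter.
pose w i := projT2 (st i).1; pose w' i := projT2 (st i).2.
have [|||||||K [k [HK kA kB]]] :=
    @amalgamation _ H A B (ultraproduct U w) (ultraproduct U w') w w'.
- by apply: ultraproduct_horn => i; have [[]] := st_spec i.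
- by apply: ultraproduct_horn => i; have [_ []] := st_spec i.
- exact: ultraproduct_saturated.
- exact: ultraproduct_saturated.
- move=> _ /e_over [k <-] /los Uk; apply/los.
  have Uk' : U [set i | k.+1 <= i] by apply: ooU; exists k.+1.
  apply: filterS (filterI Uk' Uk) => i [ki]; have [_ _ +] := st_spec i.
  exact.
- by apply/los/filterE => i; have [[]] := st_spec i.
- by move/los => /filter_ex [i]; have [_ []] := st_spec i.
exact/kB/(AB K HK k kA).
Qed.
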